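(* Let $\mathcal C$ be a category with finite products and $\blacktriangleright:\mathcal C\to\mathcal C$ an endofunctor with a natural transformation $p:\mathrm{Id}\to\blacktriangleright$. Suppose $(\mathcal C,\blacktriangleright)$ is a unique guarded fixpoint category, i.e. for every $f:\blacktriangleright X\times Y\to X$ there is a unique morphism $f^\dagger:Y\to X$ with $f^\dagger=f\cdot(p_X\times Y)\cdot\langle f^\dagger,Y\rangle$. Then $(\mathcal C,\blacktriangleright,\dagger)$ is a uniform guarded Conway category; that is, the operator $\dagger$ satisfies the fixpoint identity, the parameter identity (P), the composition identity (C), the double dagger identity ($\dagger\dagger$) and uniformity (U).
   Context: Notation: objects also denote their identity morphisms; $g\cdot f$ is composition ($f$ first); $\Delta:A\to A\times A$ is the diagonal. Guarded fixpoint category: a triple $(\mathcal C,\blacktriangleright,\dagger)$ where $\mathcal C$ has finite products, $\blacktriangleright$ is an endofunctor of $\mathcal C$ with a natural transformation $p:\mathrm{Id}\to\blacktriangleright$, and $\dagger$ is a family of operations $\dagger_{X,Y}:\mathcal C(\blacktriangleright X\times Y,X)\to\mathcal C(Y,X)$, $f\mapsto f^\dagger$, satisfying the fixpoint identity $f^\dagger=f\cdot(p_X\times Y)\cdot\langle f^\dagger,Y\rangle$. Properties: (P) for all $f:\blacktriangleright X\times Y\to X$ and $h:Z\to Y$: $f^\dagger\cdot h=(f\cdot(\blacktriangleright X\times h))^\dagger$. (C) for all $f:\blacktriangleright X\times Y\to Z$ and $g:Z\to X$: $(g\cdot f)^\dagger=g\cdot(f\cdot(\blacktriangleright g\times Y))^\dagger$.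 ($\dagger\dagger$) for all $f:\blacktriangleright X\times\blacktriangleright X\times Y\to X$: $f^{\dagger\dagger}=(f\cdot(\Delta\times Y))^\dagger$, where $f^\dagger:\blacktriangleright X\times Y\to X$ is taken with respect to the first component and $f^{\dagger\dagger}=(f^\dagger)^\dagger:Y\to X$. (U) for all $f:\blacktriangleright X\times Y\to X$, $g:\blacktriangleright X'\times Y\to X'$, $h:X\to X'$: if $h\cdot f=g\cdot(\blacktriangleright h\times Y)$ then $h\cdot f^\dagger=g^\dagger$. A guarded Conway category is a guarded fixpoint category satisfying (P), (C), ($\dagger\dagger$); it is uniform if it also satisfies (U). *)

(* Defs.v *)
From Stdlib Require Import ClassicalEpsilon.

Set Implicit Arguments.
Unset Strict Implicit.

Declare Scope cat_scope.
Delimit Scope cat_scope with cat.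
Local Open Scope cat_scope.

Reserved Notation "g ∘ f" (at level 40, left associativity).
Reserved Notation "X × Y" (at level 35, right associativity).
Reserved Notation "f ⊗ g" (at level 35, right associativity).
Reserved Notation "⟨ f , g ⟩" (at level 0, f at level 99, g at level 99).

(** [g ∘ f] is "f first"; equality of morphisms is Leibniz equality. *)
Record Category := {
  obj :> Type;
  hom : obj -> obj -> Type;
  id : forall X, hom X X;
  comp : forall X Y Z, hom Y Z -> hom X Y -> hom X Z;
  comp_id_l : forall X Y (f : hom X Y), comp (id Y) f = f;
  comp_id_r : forall X Y (f : hom X Y), comp f (id X) = f;
  comp_assoc : forall W X Y Z (h : hom Y Z) (g : hom X Y) (f : hom W X),
    comp h (comp g f) = comp (comp h g) f
}.

Arguments hom {c} X Y.
Arguments id {c} X.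
Arguments comp {c X Y Z} g f.
Notation "g ∘ f" := (comp g f) : cat_scope.

Record Functor (C D : Category) := {
  fobj :> C -> D;
  fmap : forall X Y : C, hom X Y -> hom (fobj X) (fobj Y);
  fmap_id : forall X : C, fmap (id X) = id (fobj X);
  fmap_comp : forall (X Y Z : C) (g : hom Y Z) (f : hom X Y),
    fmap (g ∘ f) = fmap g ∘ fmap f
}.

Arguments fmap {C D} F {X Y} f : rename.

Definition id_functor (C : Category) : Functor C C :=
  {| fobj := fun X => X;
     fmap := fun X Y f => f;
     fmap_id := fun X => eq_refl;
     fmap_comp := fun X Y Z g f => eq_refl |}.

Record NatTrans (C D : Category) (F G : Functor C D) := {
  component :> forall X : C, hom (F X) (G X);
  naturality : forall (X Y : C) (f : hom X Y),
    component Y ∘ fmap F f = fmap G f ∘ component X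
}.

(** Finite products, as a chosen terminal object and chosen binary products. *)
Record FiniteProducts (C : Category) := {
  terminal : C;
  bang : forall X : C, hom X terminal;
  bang_unique : forall (X : C) (f : hom X terminal), f = bang X;
  prod : C -> C -> C;
  proj1 : forall X Y : C, hom (prod X Y) X;
  proj2 : forall X Y : C, hom (prod X Y) Y;
  pair : forall X Y Z : C, hom Z X -> hom Z Y -> hom Z (prod X Y);
  proj1_pair : forall (X Y Z : C) (f : hom Z X) (g : hom Z Y),
    proj1 X Y ∘ pair f g = f;
  proj2_pair : forall (X Y Z : C) (f : hom Z X) (g : hom Z Y),
    proj2 X Y ∘ pair f g = g;
  pair_unique : forall (X Y Z : C) (f : hom Z X) (g : hom Z Y)
    (h : hom Z (prod X Y)),
    proj1 X Y ∘ h = f -> proj2 X Y ∘ h = g -> h = pair f g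
}.

Arguments prod {C} _ X Y.
Arguments proj1 {C} _ X Y.
Arguments proj2 {C} _ X Y.
Arguments pair {C} _ {X Y Z} f g.

Definition prod_map (C : Category) (P : FiniteProducts C) (X X' Y Y' : C)
    (f : hom X X') (g : hom Y Y') : hom (prod P X Y) (prod P X' Y') :=
  pair P (f ∘ proj1 P X Y) (g ∘ proj2 P X Y).

Definition diag (C : Category) (P : FiniteProducts C) (X : C)
    : hom X (prod P X X) :=
  pair P (id X) (id X).

Definition prod_assoc (C : Category) (P : FiniteProducts C) (X Y Z : C)
    : hom (prod P (prod P X Y) Z) (prod P X (prod P Y Z)) :=
  pair P (proj1 P X Y ∘ proj1 P (prod P X Y) Z)
         (pair P (proj2 P X Y ∘ proj1 P (prod P X Y) Z)
                 (proj2 P (prod P X Y) Z)).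

Arguments prod_map {C} P {X X' Y Y'} f g.
Arguments diag {C} P X.
Arguments prod_assoc {C} P X Y Z.

Section GuardedFixpoints.

Variables (C : Category) (P : FiniteProducts C) (L : Functor C C)
  (p : NatTrans (id_functor C) L).

Local Notation "X × Y" := (prod P X Y) : cat_scope.
Local Notation "f ⊗ g" := (prod_map P f g) : cat_scope.
Local Notation "⟨ f , g ⟩" := (pair P f g) : cat_scope.

Definition guarded_solution (X Y : C) (f : hom (L X × Y) X) (s : hom Y X)
    : Prop :=
  s = f ∘ (p X ⊗ id Y) ∘ ⟨ s , id Y ⟩.

Definition dagger_operator : Type :=
  forall X Y : C, hom (L X × Y) X -> hom Y X.

Section Identities.

Variable dagger : dagger_operator.
Local Notation "f †" := (dagger f) (at level 1, format "f †") : cat_scope.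

Definition fixpoint_identity : Prop :=
  forall (X Y : C) (f : hom (L X × Y) X), guarded_solution f (f†).

Definition parameter_identity : Prop :=
  forall (X Y Z : C) (f : hom (L X × Y) X) (h : hom Z Y),
    f† ∘ h = (f ∘ (id (L X) ⊗ h))†.

Definition composition_identity : Prop :=
  forall (X Y Z : C) (f : hom (L X × Y) Z) (g : hom Z X),
    (g ∘ f)† = g ∘ (f ∘ (fmap L g ⊗ id Y))†.

(** The ternary product is [L X × (L X × Y)], so that the inner dagger acts on
    the first component with parameter [L X × Y]; [prod_assoc] is the
    rebracketing needed to precompose with [diag × Y]. *)
Definition double_dagger_identity : Prop :=
  forall (X Y : C) (f : hom (L X × (L X × Y)) X),
    (f†)† = (f ∘ (prod_assoc P (L X) (L X) Y ∘ (diag P (L X) ⊗ id Y)))†.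

Definition uniformity : Prop :=
  forall (X X' Y : C) (f : hom (L X × Y) X) (g : hom (L X' × Y) X')
    (h : hom X X'),
    h ∘ f = g ∘ (fmap L h ⊗ id Y) -> h ∘ f† = g†.

Record guarded_Conway_category : Prop := {
  Conway_fixpoint : fixpoint_identity;
  Conway_parameter : parameter_identity;
  Conway_composition : composition_identity;
  Conway_double_dagger : double_dagger_identity
}.

Record uniform_guarded_Conway_category : Prop := {
  uniform_Conway : guarded_Conway_category;
  uniform_uniformity : uniformity
}.

End Identities.

Definition unique_guarded_fixpoint_category : Prop :=
  forall (X Y : C) (f : hom (L X × Y) X), exists! s : hom Y X,
    guarded_solution f s.

(** The operator sending each [f] to its unique solution. *)
Definition unique_dagger (H : unique_guarded_fixpoint_category)
    : dagger_operator :=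
  fun X Y f => proj1_sig (constructive_indefinite_description _ (H X Y f)).

End GuardedFixpoints.

Arguments guarded_solution {C} P {L} p {X Y} f s.
Arguments fixpoint_identity {C} P {L} p dagger.
Arguments parameter_identity {C} P {L} dagger.
Arguments composition_identity {C} P {L} dagger.
Arguments double_dagger_identity {C} P {L} dagger.
Arguments uniformity {C} P {L} dagger.
Arguments guarded_Conway_category {C} P {L} p dagger.
Arguments uniform_guarded_Conway_category {C} P {L} p dagger.
Arguments unique_guarded_fixpoint_category {C} P {L} p.
Arguments unique_dagger {C P L p} H X Y f.

(* Main.v *)
From Stdlib Require Import ClassicalEpsilon.
Require Import Defs.

(** A guarded solution of [f] is an [s] with [s = f ∘ ⟨p ∘ s, id⟩].  For each
    identity, one checks that one side solves the equation defining the other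
    and invokes uniqueness; composition is uniformity applied to [h := g]. *)

Local Open Scope cat_scope.

Section Products.

Variables (C : Category) (P : FiniteProducts C).

Lemma pair_comp (W X Y Z : C) (f : hom Z X) (g : hom Z Y) (h : hom W Z) :
  pair P f g ∘ h = pair P (f ∘ h) (g ∘ h).
Proof.
  apply pair_unique; rewrite comp_assoc.
  - now rewrite proj1_pair.
  - now rewrite proj2_pair.
Qed.

Lemma prod_map_pair (X X' Y Y' Z : C) (f : hom X X') (g : hom Y Y')
    (a : hom Z X) (b : hom Z Y) :
  prod_map P f g ∘ pair P a b = pair P (f ∘ a) (g ∘ b).
Proof.
  unfold prod_map.
  now rewrite pair_comp, <- !comp_assoc, proj1_pair, proj2_pair.
Qed.

(** Serves the double dagger identity, where the diagonal produces a left-nested triple. *)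
Lemma prod_assoc_pair (X Y Z W : C) (a : hom W X) (b : hom W Y) (c : hom W Z) :
  prod_assoc P X Y Z ∘ pair P (pair P a b) c = pair P a (pair P b c).
Proof.
  unfold prod_assoc.
  now rewrite !pair_comp, <- !comp_assoc, !proj1_pair, !proj2_pair.
Qed.

End Products.

Section UniqueFixpoints.

Variables (C : Category) (P : FiniteProducts C) (L : Functor C C)
  (p : NatTrans (id_functor C) L).

(** Absorbing [p X ⊗ id Y] into the pairing gives the form of the equation used in all later
    computations. *)
Lemma guarded_solutionE (X Y : C) (f : hom (prod P (L X) Y) X) (s : hom Y X) :
  guarded_solution P p f s <-> s = f ∘ pair P (p X ∘ s) (id Y).
Proof.
  unfold guarded_solution.
  now rewrite <- comp_assoc, prod_map_pair, comp_id_l.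
Qed.

Hypothesis H : unique_guarded_fixpoint_category P p.

Local Notation dagger := (unique_dagger H).

Lemma unique_dagger_fixpoint : fixpoint_identity P p dagger.
Proof.
  intros X Y f; unfold unique_dagger.
  destruct (constructive_indefinite_description _ _) as [s [Hs Huniq]]; exact Hs.
Qed.

Lemma unique_daggerE (X Y : C) (f : hom (prod P (L X) Y) X) :
  dagger X Y f = f ∘ pair P (p X ∘ dagger X Y f) (id Y).
Proof. apply guarded_solutionE, unique_dagger_fixpoint. Qed.

Lemma unique_dagger_eq (X Y : C) (f : hom (prod P (L X) Y) X) (s : hom Y X) :
  s = f ∘ pair P (p X ∘ s) (id Y) -> s = dagger X Y f.
Proof.
  intros Hs; unfold unique_dagger.
  destruct (constructive_indefinite_description _ _) as [t [Hsol Ht]]; simpl.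
  now symmetry; apply Ht, guarded_solutionE.
Qed.

(** Precomposing the equation of [f†] with [h] yields the pairing [⟨p ∘ f† ∘ h, h⟩], which is
    [id ⊗ h] after [⟨p ∘ f† ∘ h, id⟩]. *)
Lemma unique_dagger_parameter : parameter_identity P dagger.
Proof.
  intros X Y Z f h; apply unique_dagger_eq.
  rewrite unique_daggerE at 1.
  now rewrite <- !comp_assoc, pair_comp, prod_map_pair,
    !comp_id_l, comp_id_r, <- comp_assoc.
Qed.

(** After unfolding [f†] once, the hypothesis moves [h] across [f] as [fmap L h], and naturality of
    [p] turns [fmap L h ∘ p X] into [p X' ∘ h], as the equation of [g] demands. *)
Lemma unique_dagger_uniformity : uniformity P dagger.
Proof.
  intros X X' Y f g h Hfg; apply unique_dagger_eq.
  rewrite unique_daggerE at 1.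
  rewrite comp_assoc, Hfg, <- comp_assoc, prod_map_pair, comp_id_l, !comp_assoc.
  now rewrite <- (naturality p h).
Qed.

Lemma unique_dagger_composition : composition_identity P dagger.
Proof.
  (* The square from [f ∘ (fmap L g ⊗ id Y)] to [g ∘ f] commutes by associativity alone. *)
  intros X Y Z f g; symmetry; apply unique_dagger_uniformity, comp_assoc.
Qed.

Lemma unique_dagger_double_dagger : double_dagger_identity P dagger.
Proof.
  intros X Y f; apply unique_dagger_eq.
  set (t := dagger X (prod P (L X) Y) f).
  set (s := dagger X Y t).
  assert (Hs : s = t ∘ pair P (p X ∘ s) (id Y)) by apply unique_daggerE.
  assert (Ht : t = f ∘ pair P (p X ∘ t) (id _)) by apply unique_daggerE.
  rewrite <- !comp_assoc, prod_map_pair; unfold diag.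
  rewrite pair_comp, !comp_id_l, prod_assoc_pair.
  (* The goal is now [s = f ∘ ⟨p ∘ s, ⟨p ∘ s, id⟩⟩]; unfold the outer fixpoint once, then the inner
     one. *)
  rewrite Hs at 1; rewrite Ht at 1.
  rewrite <- comp_assoc, pair_comp, comp_id_l, <- comp_assoc.
  (* The first component holds [p ∘ (t ∘ ⟨p ∘ s, id⟩)], which the outer equation folds back to
     [p ∘ s]. *)
  exact (f_equal (fun u => f ∘ pair P (p X ∘ u) (pair P (p X ∘ s) (id Y)))
    (eq_sym Hs)).
Qed.

End UniqueFixpoints.

Theorem theorem3p4 (C : Category) (P : FiniteProducts C) (L : Functor C C)
    (p : NatTrans (id_functor C) L)
    (H : unique_guarded_fixpoint_category P p) :
  uniform_guarded_Conway_category P p (unique_dagger H).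
Proof.
  split; [split|].
  - apply unique_dagger_fixpoint.
  - apply unique_dagger_parameter.
  - apply unique_dagger_composition.
  - apply unique_dagger_double_dagger.
  - apply unique_dagger_uniformity.
Qed.
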